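(* For every integer $g\ge 2$, the signed graph $(\mathrm{TT}(g),J)$, which has $\lfloor g^2/2\rfloor$ vertices, is $\mathcal{SP}$-complete.
   Context: Let $a=\lfloor g/2\rfloor$ and $b=\lceil g/2\rceil$. The graph $\mathrm{T}(g)$ has vertex set $\{0,\dots,2a-1\}\times\{0,\dots,b-1\}$, with vertical edges $\{(i,j),(i,j+1)\}$ and horizontal edges $\{(i,j),(i',j)\}$ whenever $i-i'\equiv \pm1 \pmod{2a}$ (so it is the cylinder $C_{2a}\square P_b$). $\mathrm{TT}(g)$ is obtained from $\mathrm{T}(g)$ by adding, for each antipodal pair, an edge $\{(i,0),(i+a \bmod 2a,\,b-1)\}$ (these are the pairs of vertices at distance $a+b-1$ in $\mathrm{T}(g)$); the set of these added edges is $J$ (if such a pair is already a horizontal edge, as happens for $g=2$, the added edge is a parallel edge). The signed graph $(\mathrm{TT}(g),J)$ has exactly the edges of $J$ negative and all other edges positive. A signed graph $(G,\sigma)$ is a graph (loops and parallel edges allowed) with $\sigma:E(G)\to\{+,-\}$. The sign of a closed walk is the product of the signs of its edges with multiplicity. Switching at a vertex set $X$ multiplies by $-$ the signs of all edges in the cut $(X,V\setminus X)$. A closed walk has type $ij\in\mathbb{Z}_2^2$ with $i=0$ if positive, $i=1$ if negative, and $j$ the parity of its length; $g_{ij}(G,\sigma)$ is the minimum length of a closed walk of type $ij$ ($\infty$ if none). A homomorphism of $(G,\sigma)$ to $(H,\pi)$ consists of a signature $\sigma'$ switching equivalent to $\sigma$ and a mapping of vertices to vertices and edges to edges preserving adjacencies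 and incidences, with every edge $e$ mapped to an edge of sign $\sigma'(e)$. $\mathcal{SP}$ is the class of signed graphs $(G,\sigma)$ with $G$ a simple connected $K_4$-minor-free graph; $(B,\pi)$ is $\mathcal{SP}$-complete if every $(G,\sigma)\in\mathcal{SP}$ with $g_{ij}(G,\sigma)\ge g_{ij}(B,\pi)$ for all $ij\in\mathbb{Z}_2^2$ admits a homomorphism to $(B,\pi)$. *)

(* Defs.v *)
From mathcomp Require Import all_boot.
From mathcomp Require Import boolp.

Set Implicit Arguments.
Unset Strict Implicit.
Unset Printing Implicit Defensive.

(* Finite multigraphs, signed graphs. An edge has one end if it is a loop,
   two otherwise; [neg e] holds for the negative edges. *)
Record mgraph := MGraph {
  vert : finType;
  edge : finType;
  ends : edge -> {set vert};
  endsP : forall e, 0 < #|ends e| <= 2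
}.

Record sgraph := SGraph {
  sg_graph :> mgraph;
  neg : edge sg_graph -> bool
}.

Section Graphs.
Variable G : mgraph.

Definition adj : rel (vert G) :=
  [rel x y | [exists e : edge G, ends e == [set x; y]]].

Definition simple_graph : Prop :=
  (forall e : edge G, #|ends e| = 2) /\ injective (@ends G).

Definition connected_in (A : {set vert G}) : Prop :=
  A != set0 /\
  {in A &, forall x y, connect [rel u v | [&& u \in A, v \in A & adj u v]] x y}.

Definition connected_graph : Prop := connected_in [set: vert G].

(* [G] has a K_n minor: pairwise disjoint connected branch sets, with an edge
   of [G] between any two of them. *)
Definition has_complete_minor (n : nat) : Prop :=
  exists B : 'I_n -> {set vert G},
    (forall i, connected_in (B i)) /\
    (forall i j, i != j ->
       [disjoint B i & B j] /\
       exists x y, [/\ x \in B i, y \in B j & adj x y]).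

Definition cut (X : {set vert G}) : {set edge G} :=
  [set e | ~~ [disjoint ends e & X] && ~~ [disjoint ends e & ~: X]].

Definition switch (X : {set vert G}) (s : edge G -> bool) : edge G -> bool :=
  fun e => s e (+) (e \in cut X).

Definition switching_equivalent (s s' : edge G -> bool) : Prop :=
  exists X : {set vert G}, s' =1 switch X s.

(* A walk from [x] is the sequence of its steps (edge, next vertex). *)
Fixpoint walk (x : vert G) (w : seq (edge G * vert G)) : bool :=
  if w is (e, y) :: w' then (ends e == [set x; y]) && walk y w' else true.

Definition closed_walk (x : vert G) (w : seq (edge G * vert G)) : bool :=
  walk x w && (last x (unzip2 w) == x).

End Graphs.

(* A type ij in Z_2^2 is a pair of booleans: negative?, odd length? *)
Definition walk_type (G : sgraph) (w : seq (edge G * vert G)) : bool * bool :=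
  (\big[addb/false]_(s <- w) neg s.1, odd (size w)).

Definition has_closed_walk (G : sgraph) (ij : bool * bool) : pred nat :=
  fun k => [exists x : vert G, exists w : k.-tuple (edge G * vert G),
              closed_walk x w && (walk_type w == ij)].

(* g_ij, with [None] for infinity. *)
Definition girth (G : sgraph) (ij : bool * bool) : option nat :=
  if pselect (exists k, has_closed_walk G ij k) is left ex_k
  then Some (ex_minn ex_k) else None.

Definition leq_inf (m n : option nat) : bool :=
  match m, n with
  | _, None => true
  | None, Some _ => false
  | Some m', Some n' => m' <= n'
  end.

Record hom (G H : sgraph) := Hom {
  hom_sign : edge G -> bool;
  hom_vert : vert G -> vert H;
  hom_edge : edge G -> edge H;
  hom_switch : switching_equivalent (@neg G) hom_sign;
  hom_ends : forall e, ends (hom_edge e) = hom_vert @: ends e;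
  hom_neg : forall e, neg (hom_edge e) = hom_sign e
}.

Definition SP (G : sgraph) : Prop :=
  [/\ simple_graph G, connected_graph G & ~ has_complete_minor G 4].

Definition SP_complete (B : sgraph) : Prop :=
  forall G : sgraph, SP G ->
    (forall ij, leq_inf (girth B ij) (girth G ij)) -> inhabited (hom G B).

Section TT.
Variable g : nat.
Let a := g./2.
Let b := uphalf g.

Definition T_vert : finType := ('I_(2 * a) * 'I_b)%type.

Definition T_vertical : rel T_vert :=
  fun x y => (x.1 == y.1) && (y.2 == x.2.+1 :> nat).

Definition T_horizontal : rel T_vert :=
  fun x y => (x.2 == y.2) &&
    ((x.1 == y.1 + 1 %[mod 2 * a]) || (x.1 + 1 == y.1 %[mod 2 * a])).

Definition antipodal : rel T_vert :=
  fun x y => [&& x.2 == 0 :> nat, y.2 == b.-1 :> nat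
               & y.1 == (x.1 + a) %% (2 * a) :> nat].

Definition pairs_of (r : rel T_vert) : {set {set T_vert}} :=
  [set [set p.1; p.2] | p : T_vert * T_vert & r p.1 p.2].

Definition T_edges : {set {set T_vert}} :=
  pairs_of T_vertical :|: pairs_of T_horizontal.

(* One added edge for each unordered antipodal pair. *)
Definition J_edges : {set {set T_vert}} := pairs_of antipodal.

(* The sum is disjoint: an antipodal pair that is also an edge of T(g) gives
   two parallel edges. *)
Definition TT_edge : finType :=
  ({e : {set T_vert} | e \in T_edges} + {e : {set T_vert} | e \in J_edges})%type.

Definition TT_ends (e : TT_edge) : {set T_vert} :=
  match e with inl u => val u | inr u => val u end.

Lemma pairs_of_card r e : e \in pairs_of r -> 0 < #|e| <= 2.
Proof. by case/imsetP=> -[x y] _ ->; rewrite cards2; case: (_ == _). Qed.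

Lemma TT_endsP (e : TT_edge) : 0 < #|TT_ends e| <= 2.
Proof.
case: e => -[e He] /=; last exact: pairs_of_card He.
by case/setUP: He; apply: pairs_of_card.
Qed.

Definition TT : mgraph := MGraph TT_endsP.

Definition TTJ : sgraph :=
  @SGraph TT (fun e => match e with inl _ => false | inr _ => true end).

End TT.

(* Main.v *)
(** The signed double cover of TT(g) is the toroidal grid C_{2a} x C_{2b}, and
    the covering involution is the antipodal map, the translation by (a, b),
    for which d(u, -v) = g - d(u, v).  Up to switching, a homomorphism of a
    signed graph to TT(g) is thus a map phi to the torus such that phi(x) is
    adjacent to phi(y) for a positive edge xy, and to the antipode of phi(y)
    for a negative one.  The torus has the following extension property: given
    u and v at distance p, every (q, r) allowed by the parity condition, the
    triangle inequalities and p + q + r <= 2g is realised as the distances of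
    some w to u and v.

    A K_4-minor-free graph has a vertex v with at most two neighbours, and
    joining these neighbours and deleting v creates no K_4 minor.  By induction
    phi can be chosen so that, for all pairs that become adjacent, the signed
    distances of the images are at most the lengths of the shortest walks of
    each sign in G: the girth conditions on G are what the choice of (q, r) for
    the image of v requires.  On an edge of G, parity turns this upper bound
    into equality. *)

Require Import Defs.
From mathcomp Require Import all_boot all_order all_algebra.
From mathcomp Require Import boolp.
From mathcomp Require Import zify.

Set Implicit Arguments.
Unset Strict Implicit.
Unset Printing Implicit Defensive.

(** * K_4 minors and vertices of degree at most two *)

Section Minors.
Variable V : finType.
Implicit Types (e : rel V) (A B D W Z : {set V}).

Definition restr e A : rel V := [rel u v | [&& u \in A, v \in A & e u v]].

Definition conn e A : Prop :=
  A != set0 /\ {in A &, forall x y, connect (restr e A) x y}.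

Definition complete_minor_in e A n : Prop :=
  exists B : 'I_n -> {set V},
    [/\ forall i, B i \subset A, forall i, conn e (B i) &
        forall i j, i != j ->
          [disjoint B i & B j] /\ exists x y, [/\ x \in B i, y \in B j & e x y]].

Lemma connect_restrS e e' A B x y :
  A \subset B -> {in A &, forall u v, e u v -> connect (restr e' B) u v} ->
  connect (restr e A) x y -> connect (restr e' B) x y.
Proof.
move=> sAB He; apply: connect_sub => u v /and3P[uA vA euv]; exact: He.
Qed.

Lemma connect_restrW e A B x y :
  A \subset B -> connect (restr e A) x y -> connect (restr e B) x y.
Proof.
move=> sAB; apply: connect_restrS => // u v uA vA euv.
by apply: connect1; rewrite /restr /= (subsetP sAB _ uA) (subsetP sAB _ vA).
Qed.

Lemma conn1 e x : conn e [set x].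
Proof.
split; first by apply/set0Pn; exists x; rewrite set11.
by move=> u v /set1P-> /set1P->; exact: connect0.
Qed.

Lemma connU e A B x y : symmetric e -> conn e A -> conn e B ->
  x \in A -> y \in B -> e x y -> conn e (A :|: B).
Proof.
move=> se [A0 cA] [B0 cB] xA yB exy; split.
  by apply/set0Pn; exists x; rewrite inE xA.
have cAU u v : u \in A -> v \in A -> connect (restr e (A :|: B)) u v.
  by move=> uA vA; apply: connect_restrW (cA _ _ uA vA); exact: subsetUl.
have cBU u v : u \in B -> v \in B -> connect (restr e (A :|: B)) u v.
  by move=> uB vB; apply: connect_restrW (cB _ _ uB vB); exact: subsetUr.
have cxy : connect (restr e (A :|: B)) x y.
  by apply: connect1; rewrite /restr /= !inE xA yB orbT.
have cyx : connect (restr e (A :|: B)) y x.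
  by apply: connect1; rewrite /restr /= !inE xA yB orbT se.
move=> u v /setUP[uA|uB] /setUP[vA|vB]; [exact: cAU | | | exact: cBU].
- exact: connect_trans (cAU _ _ uA xA) (connect_trans cxy (cBU _ _ yB vB)).
- exact: connect_trans (cBU _ _ uB yB) (connect_trans cyx (cAU _ _ xA vA)).
Qed.

Lemma conn_path e x p : symmetric e -> path e x p -> conn e [set z in x :: p].
Proof.
move=> se; elim: p x => [|y p IH] x /=.
  move=> _; rewrite (_ : [set z in [:: x]] = [set x]); first exact: conn1.
  by apply/setP=> z; rewrite !inE.
move=> /andP[exy /IH cp].
rewrite (_ : [set z in _] = [set x] :|: [set z in y :: p]); last first.
  by apply/setP=> z; rewrite !inE.
apply: (@connU _ _ _ x y) => //; [exact: conn1 | exact: set11 | by rewrite !inE eqxx].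
Qed.

Lemma complete_minor4_intro e A B0 B1 B2 B3 : symmetric e ->
  (forall B, B \in [:: B0; B1; B2; B3] -> B \subset A /\ conn e B) ->
  pairwise (fun B C => [disjoint B & C] &&
     [exists x in B, [exists y in C, e x y]]) [:: B0; B1; B2; B3] ->
  complete_minor_in e A 4.
Proof.
move=> se HB HP; pose s := [:: B0; B1; B2; B3].
have Hin (i : 'I_4) : nth set0 s i \in s by apply: mem_nth; case: i.
exists (fun i => nth set0 s i); split => [i|i|i j].
- by case: (HB _ (Hin i)).
- by case: (HB _ (Hin i)).
wlog ltij : i j / i < j => [H nij|_].
  have [lt|lt|eq] := ltngtP i j; first exact: H.
    have [|dis [x [y [xB yB exy]]]] := H j i lt; first by rewrite eq_sym.
    by split; [rewrite disjoint_sym | exists y, x; split=> //; rewrite se].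
  by case/eqP: nij; apply: val_inj.
have /(pairwiseP set0)/(_ i j) := HP.
rewrite !inE /= => /(_ (ltn_ord i) (ltn_ord j) ltij) /andP[dis].
case/existsP=> x /andP[xB /existsP[y /andP[yB exy]]].
by split=> //; exists x, y.
Qed.

Definition nbrs e A x := [set y in A | e x y].

(* Stands for a cycle in [Z]: finite graphs of minimum degree at least 2 contain cycles. *)
Definition core e Z := (Z != set0) && [forall z in Z, 1 < #|nbrs e Z z|].

Definition has_core e D := [exists Z : {set V}, (Z \subset D) && core e Z].

Lemma has_coreP e D : reflect (exists2 Z : {set V}, Z \subset D & core e Z) (has_core e D).
Proof.
apply: (iffP existsP) => [[Z /andP[]]|[Z sZ cZ]]; first by exists Z.
by exists Z; rewrite sZ.
Qed.

Lemma not_core e Z : Z != set0 -> ~~ core e Z ->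
  exists2 z, z \in Z & #|nbrs e Z z| <= 1.
Proof.
rewrite /core => -> /=; rewrite negb_forall => /existsP[z].
by rewrite negb_imply -leqNgt => /andP[]; exists z.
Qed.

Lemma nbrsD1_card e A x f k : k < #|nbrs e A x| -> k <= #|nbrs e (A :\ f) x|.
Proof.
rewrite (cardsD1 f) => lt.
have -> : nbrs e (A :\ f) x = nbrs e A x :\ f by apply/setP=> y; rewrite !inE andbA.
by case: (f \in _) lt => //= /ltnW.
Qed.

(** All neighbours in [Z] of the first vertex of a longest path in [Z] lie on that path; one that is
    not the second vertex closes a cycle with an initial segment. *)
Lemma core_cycle e Z : symmetric e -> irreflexive e -> core e Z ->
  exists s, [/\ cycle e s, uniq s, 2 < size s & {subset s <= Z}].
Proof.
move=> se ie /andP[/set0Pn[z0 z0Z] /forallP cZ].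
pose P n := [exists t : n.-tuple V,
  [&& uniq t, all (mem Z) t & if tval t is x :: p then path e x p else false]].
have exP : exists n, P n.
  by exists 1; apply/existsP; exists [tuple z0]; rewrite /= z0Z.
have ubP n : P n -> n <= #|V|.
  move=> /existsP[t /and3P[ut _ _]].
  by rewrite -(size_tuple t) -(card_uniqP ut) max_card.
case: (ex_maxnP exP ubP) => n /existsP[t /and3P[]].
case: {t}(tval t) (size_tuple t) => // x p szp /= /andP[xp up] /andP[xZ pZ] pp maxn.
have nb y : y \in nbrs e Z x -> y \in p.
  rewrite inE => /andP[yZ exy]; case: (boolP (y \in p)) => // yp.
  have yx : y != x by apply: contraTneq exy => ->; rewrite ie.
  have /maxn : P n.+1; last by rewrite ltnn.
  have sz : size (y :: x :: p) == n.+1 by rewrite /= -szp.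
  apply/existsP; exists (Tuple sz); rewrite /= !inE negb_or yx yp xp up.
  by move: pZ yZ xZ => /= -> -> ->; rewrite se exy.
have := cZ x; rewrite xZ /= => c2.
case: p nb pp xp up pZ szp maxn => [|p1 p2] nb pp xp up pZ szp maxn.
  have : nbrs e Z x = set0 by apply/setP=> y; rewrite [RHS]inE; apply/negP=> /nb.
  by move=> E; rewrite E cards0 in c2.
have [y yN yp1] : exists2 y, y \in nbrs e Z x & y != p1.
  move: c2; rewrite (cardsD1 p1).
  case: (set_0Vmem (nbrs e Z x :\ p1)) => [->|[y]].
    by rewrite cards0 addn0; case: (p1 \in nbrs e Z x).
  by rewrite in_setD1 => /andP[? ?] _; exists y.
have := nb _ yN; rewrite inE (negPf yp1) /= => yp2.
have exy : e x y by move: yN; rewrite inE => /andP[].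
move: pp xp up pZ {nb szp maxn c2}; case/splitPr: yp2 => q1 q2.
rewrite -cat_rcons -cat_cons mem_cat cat_path cat_uniq all_cat negb_or.
set c := p1 :: rcons q1 y => /andP[pc _] /andP[xc _] /andP[uc _] /andP[cZ' _].
have [lc sc] : last x c = y /\ 1 < size c by rewrite /c /= last_rcons size_rcons.
clearbody c; exists (x :: c); split=> //=.
- by rewrite rcons_path pc lc se.
- by rewrite xc.
- by move=> z; rewrite inE => /predU1P[->//|/(allP cZ')].
Qed.

Lemma cycle_core e s : symmetric e -> cycle e s -> uniq s -> 2 < size s ->
  core e [set z in s].
Proof.
move=> se cs us szs; apply/andP; split.
  by apply/set0Pn; case: s szs {cs us} => // x s _; exists x; rewrite !inE eqxx.
apply/forallP=> z; apply/implyP; rewrite inE => zs.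
have [i p Ep] := rot_to zs.
have E : forall y, (y \in s) = (y \in z :: p) by move=> y; rewrite -Ep mem_rot.
have : cycle e (z :: p) by rewrite -Ep rot_cycle.
have : uniq (z :: p) by rewrite -Ep rot_uniq.
have : 2 < size (z :: p) by rewrite -Ep size_rot.
case/lastP: p {Ep} E => [|[|p1 p] y] // E _ /= /and3P[zp p1p up].
rewrite rcons_path last_rcons => /and3P[e1 _ e2].
have -> : 2 = #|[set p1; y]|.
  by rewrite cards2; case: eqVneq p1p => // ->; rewrite mem_rcons mem_head.
apply: subset_leq_card; apply/subsetP=> u; rewrite !inE E => /orP[]/eqP->.
  by rewrite !inE eqxx orbT.
by rewrite !inE mem_rcons mem_head !orbT se.
Qed.

(** Cutting the cycle at [f1], [f2], [f3] gives three arcs, each adjacent to the next; together with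
    [W] they are the four branch sets. *)
Lemma cycle_minor e A W p1 p2 p3 f1 f2 f3 : symmetric e ->
  conn e W -> W \subset A -> let s := f1 :: p1 ++ f2 :: p2 ++ f3 :: p3 in
  cycle e s -> uniq s -> {subset s <= A :\: W} ->
  {in [:: f1; f2; f3], forall f, exists2 w, w \in W & e f w} ->
  complete_minor_in e A 4.
Proof.
move=> se cW sWA s cs us sA Hf.
pose B f p := [set z in f :: p : seq V].
have [sub1 sub2 sub3] : [/\ {subset f1 :: p1 <= s}, {subset f2 :: p2 <= s} &
    {subset f3 :: p3 <= s}].
  by split=> z; rewrite /s !(inE, mem_cat) => /orP[->|->]; rewrite ?orbT.
have BA f p : {subset f :: p <= s} -> B f p \subset A.
  move=> sp; apply/subsetP=> z; rewrite inE => /sp/sA; by rewrite inE => /andP[].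
have BW f p : {subset f :: p <= s} -> [disjoint W & B f p].
  move=> sp; rewrite disjoint_sym; apply/pred0P=> z /=; apply/negbTE.
  by rewrite inE; apply/negP=> /andP[/sp/sA]; rewrite inE => /andP[/negPf->].
have WB f p : f \in [:: f1; f2; f3] -> [exists x in W, [exists y in B f p, e x y]].
  move=> /Hf[w wW efw]; apply/existsP; exists w; rewrite wW.
  by apply/existsP; exists f; rewrite !inE eqxx se.
move: cs; rewrite /s /= rcons_cat cat_path /= rcons_cat cat_path /= rcons_path.
move=> /and5P[c1 e12 c2 e23 /andP[c3 e31]].
have dis p q : uniq (p ++ q) -> [disjoint [set z in p : seq V] & [set z in q : seq V]].
  rewrite cat_uniq => /and3P[_ /hasPn H _]; rewrite disjoint_sym.
  by apply/pred0P=> z /=; rewrite !inE; apply/andP=> -[/H/negP].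
have Es : s = (f1 :: p1) ++ (f2 :: p2) ++ (f3 :: p3) by [].
have us12 : uniq ((f1 :: p1) ++ (f2 :: p2)).
  by move: us; rewrite Es catA cat_uniq => /andP[].
have us23 : uniq ((f2 :: p2) ++ (f3 :: p3)).
  by move: us; rewrite Es cat_uniq => /and3P[].
have us13 : uniq ((f1 :: p1) ++ (f3 :: p3)).
  by move: us; rewrite Es uniq_catCA cat_uniq => /and3P[].
apply: (@complete_minor4_intro e A W (B f1 p1) (B f2 p2) (B f3 p3)) => //.
  by move=> C; rewrite !inE => /or4P[]/eqP->; split=> //; first [exact: BA | exact: conn_path].
have link f p f' p' : e (last f p) f' -> [exists x in B f p, [exists y in B f' p', e x y]].
  move=> el; apply/existsP; exists (last f p); rewrite inE mem_last.
  by apply/existsP; exists f'; rewrite !inE eqxx.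
have link' f p f' p' : e (last f p) f' -> [exists y in B f' p', [exists x in B f p, e y x]].
  move=> el; apply/existsP; exists f'; rewrite !inE eqxx.
  by apply/existsP; exists (last f p); rewrite inE mem_last se.
rewrite /= !BW // !WB ?inE ?eqxx ?orbT //= !dis //.
by rewrite (link f1 p1 f2 p2) // (link f2 p2 f3 p3) // (link' f3 p3 f1 p1).
Qed.

(* Take [D] minimal.  Removing from [D] a vertex [f] of the set [F] of neighbours of
   [W] and adding it to [W] leaves [D] without a core, so every cycle in [D] contains
   all of [F].  If [F] has three elements, such a cycle and [W] give the minor; if it
   has at most two, counting degrees produces a core of [D] missing one of them. *)
Lemma core_minor e A D W : symmetric e -> irreflexive e ->
  (forall x, x \in A -> 2 < #|nbrs e A x|) ->
  D \subset A -> has_core e D -> conn e W -> W \subset A :\: D ->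
  (forall x y, x \in D -> y \in A -> e x y -> y \in D :|: W) ->
  complete_minor_in e A 4.
Proof.
move=> se ie deg; have [n] := ubnP #|D|; elim: n D W => // n IH D W.
rewrite ltnS => leDn sDA coreD cW sWA clD.
have sWA' : W \subset A by apply: subset_trans sWA (subsetDl _ _).
have WD w : w \in W -> w \notin D by move/(subsetP sWA); rewrite inE => /andP[].
pose F := [set f in D | [exists w in W, e f w]].
have FP f : f \in F -> f \in D /\ exists2 w, w \in W & e f w.
  by rewrite inE => /andP[fD /existsP[w /andP[]]]; split=> //; exists w.
(* Outside [F], a vertex of [D] has all its neighbours in [A] inside [D], hence at least three. *)
have degD x : x \in D -> x \notin F -> 2 < #|nbrs e D x|.
  move=> xD xF; apply: leq_trans (deg x (subsetP sDA _ xD)) _.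
  apply: subset_leq_card; apply/subsetP=> y; rewrite !inE => /andP[yA exy].
  rewrite exy andbT; have /setUP[//|yW] := clD _ _ xD yA exy.
  by move: xF; rewrite inE xD /= => /existsP[]; exists y; rewrite yW.
have D3 : 2 < #|D|.
  have [Z sZD /andP[/set0Pn[z zZ] /forallP/(_ z)]] := has_coreP _ _ coreD.
  rewrite zZ /= => c2; apply: leq_trans (subset_leq_card sZD).
  rewrite (cardsD1 z) zZ ltnS; apply: leq_trans c2 _; apply: subset_leq_card.
  apply/subsetP=> y; rewrite !inE => /andP[-> ezy]; rewrite andbT.
  by apply: contraTneq ezy => ->; rewrite ie.
have [/existsP[f /andP[fF cf]]|] := boolP [exists f in F, has_core e (D :\ f)].
  have [fD [w wW efw]] := FP _ fF.
  apply: (IH (D :\ f) (f |: W)) => //.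
  - by move: leDn; rewrite (cardsD1 f) fD.
  - by apply: subset_trans sDA; exact: subsetDl.
  - by apply: (@connU _ _ _ f w) => //; [exact: conn1 | exact: set11].
  - apply/subsetP=> z; rewrite !inE => /orP[/eqP->|zW].
      by rewrite eqxx (subsetP sDA).
    by rewrite (negPf (WD _ zW)) andbF (subsetP sWA').
  - move=> x y; rewrite !inE => /andP[_ xD] yA exy.
    by have := clD _ _ xD yA exy; rewrite !inE; case: (y == f).
rewrite negb_exists => /forallP noF.
have nocore f Z : f \in F -> Z \subset D :\ f -> ~~ core e Z.
  move=> fF sZ; apply/negP=> cZ; have := noF f; rewrite fF /=.
  by case/negP; apply/has_coreP; exists Z.
(* If no edge joins [D] to [W], the descent restarts with a single vertex of [D] as [W]: degrees
   within [D] are at least 3, so the rest of [D] is a core. *)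
have [F0|[f0 f0F]] := set_0Vmem F.
  have /card_gt0P[f fD] : 0 < #|D| by apply: ltn_trans D3.
  apply: (IH (D :\ f) [set f]).
  - by move: leDn; rewrite (cardsD1 f) fD.
  - by apply: subset_trans sDA; exact: subsetDl.
  - apply/has_coreP; exists (D :\ f) => //; apply/andP; split.
      by rewrite -card_gt0; move: D3; rewrite (cardsD1 f) fD; case: #|_|.
    apply/forallP=> z; apply/implyP; rewrite !inE => /andP[_ zD].
    by apply: nbrsD1_card; apply: degD => //; rewrite F0 inE.
  - exact: conn1.
  - by apply/subsetP=> z /set1P->; rewrite !inE eqxx (subsetP sDA).
  - move=> x y; rewrite !inE => /andP[_ xD] yA exy.
    have := clD _ _ xD yA exy; case: eqP => //= _; rewrite !inE => /orP[->//|yW].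
    have : x \in F by rewrite inE xD; apply/existsP; exists y; rewrite yW.
    by rewrite F0 inE.
have [F3|F2] := ltnP 2 #|F|.
  have [Z sZD cZ] := has_coreP _ _ coreD.
  have [s [cs us s3 sZ]] := core_cycle se ie cZ.
  have sD z : z \in s -> z \in D by move/sZ/(subsetP sZD).
  have Fs f : f \in F -> f \in s.
    move=> fF; apply: contraTT (cycle_core se cs us s3) => fs.
    apply: (nocore f) => //; apply/subsetP=> z; rewrite !inE => zs.
    by rewrite sD // andbT; apply: contraNneq fs => <-.
  have [f1 [f2 [f3 [F1 [F2 [F3' [n12 n13 n23]]]]]]] : exists f1 f2 f3,
      f1 \in F /\ f2 \in F /\ f3 \in F /\ [/\ f1 != f2, f1 != f3 & f2 != f3].
    move/card_gt2P: F3 => [x [y [z [[? ? ?] [n1 n2 n3]]]]]; exists x, y, z.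
    by do 3 (split=> //); split=> //; rewrite eq_sym.
  have [i p Ep] := rot_to (Fs _ F1).
  have E y : (y \in s) = (y \in f1 :: p) by rewrite -Ep mem_rot.
  have cs' : cycle e (f1 :: p) by rewrite -Ep rot_cycle.
  have us' : uniq (f1 :: p) by rewrite -Ep rot_uniq.
  have sA' : {subset f1 :: p <= A :\: W}.
    move=> z; rewrite -E => /sD zD; rewrite inE (subsetP sDA) // andbT.
    by apply: contraTN zD; exact: WD.
  have := Fs _ F2; rewrite E inE eq_sym (negPf n12) /= => f2p.
  have := Fs _ F3'; rewrite E inE eq_sym (negPf n13) /= => f3p.
  have {}FP f : f \in F -> exists2 w, w \in W & e f w by move/FP=> [].
  have Hf : {in [:: f1; f2; f3], forall f, exists2 w, w \in W & e f w}.
    by move=> f; rewrite !inE => /or3P[]/eqP->; exact: FP.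
  have Hf' : {in [:: f1; f3; f2], forall f, exists2 w, w \in W & e f w}.
    by move=> f; rewrite !inE => /or3P[]/eqP->; exact: FP.
  move: f3p cs' us' sA' {Ep E}; case/splitPr: f2p => q1 q2.
  (* The three vertices occur on the cycle in one of two cyclic orders. *)
  rewrite mem_cat inE eq_sym (negPf n23) /= => /orP[] /splitPr[r1 r2] cs' us' sA'.
    rewrite -catA /= in cs' us' sA'.
    exact: (@cycle_minor e A W r1 r2 q2 f1 f3 f2).
  exact: (@cycle_minor e A W q1 r1 r2 f1 f2 f3).
(* Now [F] has one or two elements. Since [D :\ f1] is no core, it has a vertex with at most one
   neighbour in it; this vertex is in [F], so it is [f2], and [f2] differs from [f1]. The same holds
   with the roles exchanged. *)
exfalso.
have [f1 [f2 [f1F f2F FE]]] : exists f1 f2, [/\ f1 \in F, f2 \in F &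
    forall f, f \in F -> (f == f1) || (f == f2)].
  have [F1|[f1 f1F]] := set_0Vmem (F :\ f0).
    exists f0, f0; split=> // f fF; rewrite orbb.
    by move/setP/(_ f): F1; rewrite in_setD1 fF andbT in_set0 => /negbFE.
  exists f0, f1; move: f1F; rewrite in_setD1 => /andP[n1 f1F].
  split=> // f fF.
  apply: contraTT F2; rewrite negb_or -ltnNge => /andP[n2 n3].
  apply/card_gt2P; exists f0, f1, f; split; split=> //; by rewrite ?inE // eq_sym.
have D2 f : #|D :\ f| != 0 by move: D3; rewrite (cardsD1 f); case: (f \in D); case: #|_|.
have bad f f' : f \in F -> f' \in F -> (forall h, h \in F -> (h == f) || (h == f')) ->
    f' != f /\ #|nbrs e (D :\ f) f'| <= 1.
  move=> fF f'F H.
  have [|z] := @not_core e (D :\ f) _ (nocore f _ fF (subxx _)); first by rewrite -cards_eq0.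
  rewrite !inE => /andP[zf zD] z1.
  have zF : z \in F.
    apply: contraTT z1 => zF; rewrite -ltnNge; apply: nbrsD1_card; exact: degD.
  by have := H _ zF; rewrite (negPf zf) => /= /eqP E; rewrite -E.
have [n21 b2] := bad f1 f2 f1F f2F FE.
have [n12 b1] : f1 != f2 /\ #|nbrs e (D :\ f2) f1| <= 1.
  by apply: bad => // h /FE; rewrite orbC.
(* A vertex [l] of [T] with at most one neighbour in [T] has at least three in [D], so it is
   adjacent to [f1] and [f2] and is the only neighbour of either in [T]. The other vertices of [T]
   then have all their neighbours in [D] inside [T], which makes [T :\ l] a core avoiding [F]. *)
pose T := D :\ f1 :\ f2.
have [f1D _] := FP _ f1F; have [f2D _] := FP _ f2F.
have T0 : T != set0.
  rewrite -card_gt0; move: D3; rewrite (cardsD1 f1) (cardsD1 f2 (D :\ f1)) -/T f1D.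
  by case: (f2 \in _); case: #|T|.
have sT : T \subset D :\ f1 by apply: subsetDl.
have [l lT l1] := not_core T0 (nocore f1 T f1F sT).
have TF x : x \in T -> [/\ x \in D, x != f1, x != f2 & x \notin F].
  rewrite !inE => /and3P[x2 x1 xD]; split=> //.
  by apply/negP=> xF; have := FE x; rewrite inE => /(_ xF); rewrite (negPf x1) (negPf x2).
have [lD nl1 nl2 lF] := TF _ lT.
have degl := degD _ lD lF.
have Tn x : nbrs e T x = nbrs e D x :\ f1 :\ f2 by apply/setP=> y; rewrite !inE !andbA.
have [el1 el2 l0] : [/\ e l f1, e l f2 & 0 < #|nbrs e T l|].
  move: degl l1; rewrite (Tn l) (cardsD1 f1) (cardsD1 f2 (_ :\ f1)) !inE n21 f1D f2D /=.
  by case: (e l f1); case: (e l f2); case: #|_| => [|[]].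
have only x f f' : x \in D -> x != f -> e x f' -> l != f -> e l f' ->
   #|nbrs e (D :\ f) f'| <= 1 -> x = l.
  move=> xD xf exf lf elf c1; apply/eqP; apply: contraTT c1 => xl.
  rewrite -ltnNge; apply/card_gt1P; exists x, l; split=> //.
  - by rewrite !inE xf xD se.
  - by rewrite !inE lf lD se.
have /negP[] := nocore f1 (T :\ l) f1F (subset_trans (subsetDl _ _) sT).
apply/andP; split.
  have /card_gt0P[y] := l0; rewrite inE => /andP[yT ely].
  apply/set0Pn; exists y; rewrite in_setD1 yT andbT.
  by apply: contraTneq ely => ->; rewrite ie.
apply/forallP=> x; apply/implyP; rewrite in_setD1 => /andP[xl xT].
have [xD x1 x2 xF] := TF _ xT.
apply: nbrsD1_card; suff -> : nbrs e T x = nbrs e D x by exact: degD.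
rewrite Tn; apply/setP=> y; rewrite !inE.
have [->|_] := eqVneq y f2.
  by apply/esym/negbTE; apply: contra xl => /andP[_ ex]; apply/eqP; apply: (only x f1 f2).
have [->|//] := eqVneq y f1.
by apply/esym/negbTE; apply: contra xl => /andP[_ ex]; apply/eqP; apply: (only x f2 f1).
Qed.

(** The descent starts from one vertex against all the others. *)
Lemma min_degree3_minor e A : symmetric e -> irreflexive e -> A != set0 ->
  (forall x, x \in A -> 2 < #|nbrs e A x|) -> complete_minor_in e A 4.
Proof.
move=> se ie /set0Pn[v vA] deg.
apply: (@core_minor e A (A :\ v) [set v]) => //.
- exact: subsetDl.
- apply/has_coreP; exists (A :\ v) => //; apply/andP; split.
    have /card_gt0P[y] : 0 < #|nbrs e A v| by apply: leq_trans (deg v vA).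
    rewrite inE => /andP[yA evy]; apply/set0Pn; exists y; rewrite !inE yA andbT.
    by apply: contraTneq evy => ->; rewrite ie.
  apply/forallP=> z; apply/implyP; rewrite inE => /andP[_ zA].
  exact/nbrsD1_card/deg.
- exact: conn1.
- by apply/subsetP=> z /set1P->; rewrite !inE eqxx vA.
- by move=> x y _ yA _; rewrite !inE yA; case: (y == v).
Qed.

(** * Elimination of a vertex of degree at most two *)

Definition fill e v : rel V :=
  [rel u w | e u w || [&& u != w, e v u & e v w]].

Lemma fill_sym e v : symmetric e -> symmetric (fill e v).
Proof. by move=> se u w; rewrite /fill /= se eq_sym [e v u && _]andbC. Qed.

Lemma fill_irr e v : irreflexive e -> irreflexive (fill e v).
Proof. by move=> ie u; rewrite /fill /= ie eqxx. Qed.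

(** With at most two neighbours in [A], filling at [v] amounts to contracting an edge from [v] to
    [x]: every new edge inside [A] has [x] as an end. So [v] joins the branch set containing [x], if
    there is one. *)
Lemma fill_minor e A v n : symmetric e -> v \in A -> #|nbrs e A v| <= 2 ->
  complete_minor_in (fill e v) (A :\ v) n -> complete_minor_in e A n.
Proof.
move=> se vA deg2 [B [BA cB aB]].
have BAv i u : u \in B i -> u != v /\ u \in A.
  by move/(subsetP (BA i)); rewrite !inE => /andP[].
have [N0|[x xN]] := set_0Vmem (nbrs e A v).
  have fe i j u w : u \in B i -> w \in B j -> fill e v u w -> e u w.
    move=> uB wB /orP[//|/and3P[_ evu _]].
    have : u \in nbrs e A v by rewrite inE evu; case: (BAv _ _ uB) => _ ->.
    by rewrite N0 inE.
  exists B; split=> [i|i|i j nij].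
  - by apply: subset_trans (BA i) _; exact: subsetDl.
  - case: (cB i) => B0 cBi; split=> // u w uB wB.
    apply: connect_restrS (cBi _ _ uB wB) => // a b aBi bBi /(fe i i) eab.
    by apply: connect1; rewrite /restr /= aBi bBi eab.
  - have [dis [u [w [uB wB /(fe i j) euw]]]] := aB _ _ nij.
    by split=> //; exists u, w; split=> //; exact: euw.
have [evx xA] : e v x /\ x \in A by move: xN; rewrite inE => /andP[].
have fx i j u w : u \in B i -> w \in B j -> fill e v u w ->
    [\/ e u w, u = x /\ e v w | w = x /\ e v u].
  move=> uB wB /orP[?|/and3P[nuw evu evw]]; first by constructor 1.
  have [_ uA] := BAv _ _ uB; have [_ wA] := BAv _ _ wB.
  have [->|nxu] := eqVneq u x; first by constructor 2.
  have [->|nxw] := eqVneq w x; first by constructor 3.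
  move: deg2; rewrite leqNgt => /card_gt2P[]; exists u, w, x.
  by split; split; rewrite ?inE ?uA ?wA ?xA // eq_sym.
pose B' i := if x \in B i then v |: B i else B i.
have BB' i : B i \subset B' i by rewrite /B'; case: ifP => // _; exact: subsetUr.
have B'S i : {subset B' i <= v |: B i}.
  by rewrite /B'; case: ifP => _ u // uB; rewrite inE uB orbT.
exists B'; split=> [i|i|i j nij].
- apply/subsetP=> u /B'S; rewrite !inE => /orP[/eqP->//|/BAv[]//].
- have [B0 cBi] := cB i; rewrite /B'; case: ifPn => xB; last first.
    split=> // u w uB wB.
    apply: connect_restrS (cBi _ _ uB wB) => // a b aBi bBi fab.
    apply: connect1; rewrite /restr /= aBi bBi.
    have [//|[E _]|[E _]] := fx _ _ _ _ aBi bBi fab.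
      by rewrite -E aBi in xB.
    by rewrite -E bBi in xB.
  have step u : u \in B i -> e v u -> connect (restr e (v |: B i)) v u /\
                                      connect (restr e (v |: B i)) u v.
    by move=> uB evu; split; apply: connect1; rewrite /restr /= !inE eqxx uB orbT ?[e u v]se.
  have [vx xv] := step x xB evx.
  have cB' u w : u \in B i -> w \in B i -> connect (restr e (v |: B i)) u w.
    move=> uB wB; apply: connect_restrS (cBi _ _ uB wB); first exact: subsetUr.
    move=> a b aBi bBi fab.
    have [eab|[-> eb]|[-> ea]] := fx _ _ _ _ aBi bBi fab.
    - by apply: connect1; rewrite /restr /= !inE aBi bBi !orbT.
    - by apply: connect_trans xv _; case: (step b bBi eb).
    - by apply: connect_trans vx; case: (step a aBi ea).
  split; first by apply/set0Pn; exists v; rewrite !inE eqxx.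
  move=> u w /setU1P[->|uB] /setU1P[->|wB]; first exact: connect0.
  + exact: connect_trans vx (cB' _ _ xB wB).
  + exact: connect_trans (cB' _ _ uB xB) xv.
  + exact: cB'.
have [dis [u [w [uB wB fuw]]]] := aB _ _ nij; split.
  apply/pred0P=> z /=; apply/negbTE/negP=> /andP[zi zj].
  have xij : ~ (x \in B i /\ x \in B j).
    by move=> [xi xj]; move/pred0P/(_ x): dis; rewrite /= xi xj.
  have [E|nzv] := eqVneq z v; last first.
    have := B'S _ _ zi; have := B'S _ _ zj; rewrite !inE (negPf nzv) /= => zBj zBi.
    by move/pred0P/(_ z): dis; rewrite /= zBi zBj.
  have xB k : z \in B' k -> x \in B k.
    by rewrite /B'; case: ifP => // _ /BAv[]; rewrite E eqxx.
  by apply: xij; split; apply: xB.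
have vB' k : x \in B k -> v \in B' k by rewrite /B' => ->; rewrite !inE eqxx.
have [euw|[E evw]|[E evu]] := fx _ _ _ _ uB wB fuw.
- by exists u, w; split=> //; apply: (subsetP (BB' _)).
- by exists v, w; split=> //; [apply: vB'; rewrite -E | apply: (subsetP (BB' _))].
- by exists u, v; split=> //; [apply: (subsetP (BB' _)) | apply: vB'; rewrite -E | rewrite se].
Qed.

(** The relation changes together with the vertex set, so [P] depends on both. A vertex to eliminate
    exists because minimum degree 3 would force a minor. *)
Lemma K4_minor_free_ind (P : rel V -> {set V} -> Prop) :
  (forall e, P e set0) ->
  (forall e A v, symmetric e -> irreflexive e -> v \in A -> #|nbrs e A v| <= 2 ->
     P (fill e v) (A :\ v) -> P e A) ->
  forall e A, symmetric e -> irreflexive e -> ~ complete_minor_in e A 4 -> P e A.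
Proof.
move=> P0 PS e A; have [n] := ubnP #|A|; elim: n e A => // n IH e A.
rewrite ltnS => leAn se ie noK; have [->|A0] := eqVneq A set0; first exact: P0.
have [/exists_inP[v vA v2]|] := boolP [exists v in A, #|nbrs e A v| <= 2]; last first.
  rewrite negb_exists_in => /forall_inP deg; case: noK; apply: min_degree3_minor => // x xA.
  by rewrite ltnNge deg.
apply: (PS _ _ v) => //; apply: IH; first by rewrite (cardsD1 v) vA in leAn.
- exact: fill_sym.
- exact: fill_irr.
- by move=> /(fill_minor se vA v2).
Qed.
End Minors.

(** * Distances on cycles and tori *)

Import GRing.Theory.

(** A relational form of the distance from 0 to [z] on the cycle of length [2 * n], suited to linear
    arithmetic; values of [cdist] are proved by exhibiting [k]. *)
Definition cyc_rep (n : nat) (z : int) (x : nat) : Prop :=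
  x <= n /\ exists k : int,
    (z = x%:Z + k * (2 * n)%:Z \/ z = - x%:Z + k * (2 * n)%:Z)%R.

Definition cdist (n : nat) (z : int) : nat :=
  minn `|(z %% (2 * n)%:Z)%Z| `|((- z) %% (2 * n)%:Z)%Z|.

Lemma cyc_rep_uniq n z x y : 0 < n -> cyc_rep n z x -> cyc_rep n z y -> x = y.
Proof.
move=> n0 [xn [k Hk]] [yn [l Hl]].
have [j Ej] : exists j, j = (k - l)%R by exists (k - l)%R.
have Ek : k = (l + j)%R by lia.
rewrite {}Ek mulrDl in Hk.
(* The signed representatives differ by [j] times [2 * n], while [x + y] is at most [2 * n]; so [j]
   is -1, 0 or 1, and -1 and 1 force both [x] and [y] to be [n]. *)
have [H|[H|[H|[H|H]]]] : (j <= -2 \/ j = -1 \/ j = 0 \/ j = 1 \/ 2 <= j)%R by lia.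
- by nia.
- by rewrite H in Hk; lia.
- by rewrite H in Hk; lia.
- by rewrite H in Hk; lia.
- by nia.
Qed.

Lemma cdist_rep n z : 0 < n -> cyc_rep n z (cdist n z).
Proof.
move=> n0; rewrite /cdist.
have m0 : ((2 * n)%:Z != 0)%R by lia.
have := modz_ge0 z m0; have := modz_ge0 (- z)%R m0.
have := ltz_pmod z (_ : 0 < (2 * n)%:Z)%R; have := ltz_pmod (- z)%R (_ : 0 < (2 * n)%:Z)%R.
have := divz_eq z (2 * n)%:Z; have := divz_eq (- z)%R (2 * n)%:Z.
move: (modz z _) (modz (- z)%R _) (divz z _) (divz (- z)%R _) => r r' q q' E' E.
move=> /(_ ltac:(lia)) l' /(_ ltac:(lia)) l g' g.
(* The residues of [z] and [- z] add up to a multiple of [2 * n] below [4 * n], so the smaller one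
   is at most [n]. *)
have half s s' (t : int) : (0 <= s -> 0 <= s' -> s < (2 * n)%:Z -> s' < (2 * n)%:Z ->
    s' = - s + t * (2 * n)%:Z -> s + s' <= (2 * n)%:Z)%R.
  move=> s0 s'0 sm s'm Et; have [t2|[t1|t0]] : (2 <= t \/ t = 1 \/ t <= 0)%R by lia.
  - by nia.
  - by rewrite t1 in Et; lia.
  - by nia.
have [lt|ge] := leqP `|r| `|r'|.
  split; last by exists q; lia.
  by have := half r r' (- q - q')%R; lia.
split; last by exists (- q')%R; lia.
by have := half r' r (- q - q')%R; lia.
Qed.

Lemma cdistE n z x : 0 < n -> cyc_rep n z x -> cdist n z = x.
Proof. by move=> n0; apply: cyc_rep_uniq => //; apply: cdist_rep. Qed.

(* [p + q + r <= 2 * n] is the triangle inequality with one point replaced by its antipode. *)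
Definition good_triple (n p q r : nat) : bool :=
  [&& p <= q + r, q <= p + r, r <= p + q, p + q + r <= 2 * n & ~~ odd (p + q + r)].

Lemma cdist_good n z w : 0 < n -> good_triple n (cdist n (z + w)) (cdist n z) (cdist n w).
Proof.
move=> n0; have := cdist_rep z n0; have := cdist_rep w n0.
move: (cdist n z) (cdist n w) => x y [yn [l Hl]] [xn [k Hk]].
have [s [Hs Es]] : exists s : int, [\/ s = x%:Z + y%:Z, s = x%:Z - y%:Z,
    s = - x%:Z + y%:Z | s = - x%:Z - y%:Z]%R /\ (z + w = s + (k + l) * (2 * n)%:Z)%R.
  case: Hk Hl => [->|->] [->|->]; rewrite mulrDl.
  - by exists (x%:Z + y%:Z)%R; split; [constructor 1 | lia].
  - by exists (x%:Z - y%:Z)%R; split; [constructor 2 | lia].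
  - by exists (- x%:Z + y%:Z)%R; split; [constructor 3 | lia].
  - by exists (- x%:Z - y%:Z)%R; split; [constructor 4 | lia].
have -> : cdist n (z + w) = if `|s|%N <= n then `|s|%N else 2 * n - `|s|%N.
  apply: cdistE => //; rewrite Es; case: leqP => sn; split; try lia.
    by exists (k + l)%R; lia.
  have [s0|s0] : (0 <= s \/ s < 0)%R by lia.
    by exists (k + l + 1)%R; lia.
  by exists (k + l - 1)%R; lia.
clear Hk Hl Es; rewrite /good_triple; case: (leqP `|s| n) => ?; case: Hs => Hs; lia.
Qed.

Lemma cdist_le n z : 0 < n -> cdist n z <= n.
Proof. by move=> /(@cdist_rep n z)[]. Qed.

Lemma cdistN n z : 0 < n -> cdist n (- z) = cdist n z.
Proof.
move=> n0; apply: cdistE => //; have [? [k Hk]] := cdist_rep z n0.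
by split=> //; exists (- k)%R; lia.
Qed.

Lemma cdist_antipode n z : 0 < n -> cdist n (z + n%:Z) = n - cdist n z.
Proof.
move=> n0; apply: cdistE => //; have [? [k Hk]] := cdist_rep z n0.
split; first by lia.
by case: Hk => Hk; [exists (k + 1)%R | exists k]; lia.
Qed.

Lemma cdistDm n z k : 0 < n -> cdist n (z + k * (2 * n)%:Z) = cdist n z.
Proof.
move=> n0; apply: cdistE => //; have [? [l Hl]] := cdist_rep z n0.
by split=> //; exists (l + k)%R; rewrite mulrDl; lia.
Qed.

(** Distances of a point of the cycle from two points at distance [x]: it is on a shortest arc
    between them, or the three distances go once round the cycle, or one of the two given points
    lies between the other and the new one. *)
Definition cyc_edge_triple (n x q r : nat) : Prop :=
  [/\ x <= q + r, q + r <= 2 * n - x, q <= x + r & r <= x + q] /\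
  [\/ q + r = x, q + r = 2 * n - x, q = x + r | r = x + q].

Lemma cdist_extend n u v q r : 0 < n -> cyc_edge_triple n (cdist n (u - v)) q r ->
  exists w, cdist n (u - w) = q /\ cdist n (v - w) = r.
Proof.
move=> n0; have [xn [k Hk]] := cdist_rep (u - v)%R n0.
move: (cdist _ _) xn Hk => x xn Hk [[t1 t2 t3 t4] H].
have [e Euv] : exists e : bool,
    (u - v = (if e then x%:Z else - x%:Z) + k * (2 * n)%:Z)%R.
  by case: Hk => Hk; [exists true | exists false].
(* The point [w] is [q] steps away from [u]: towards [v] if [q + r = x] or [q = x + r], in the
   opposite direction otherwise. *)
exists (if (q + r == x) || (q == x + r) then (if e then u - q%:Z else u + q%:Z)
        else (if e then u + q%:Z else u - q%:Z))%R.
split; apply: cdistE => //.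
  split; first by case: H; lia.
  by exists 0%R; clear; case: ifP; case: e; lia.
split; first by case: H; lia.
case: ifP => E.
  by exists (- k)%R; case: e Euv; lia.
have [E2|E2] : (q + r)%N = 2 * n - x \/ r = x + q by case: H; lia.
  by case: e Euv => Euv; [exists (- k - 1)%R | exists (- k + 1)%R]; lia.
by exists (- k)%R; case: e Euv; lia.
Qed.

(* In the coordinates [q + r] and [q - r] the pairs allowed by [cyc_edge_triple] form the
   boundary of a rectangle; since [b] is [a] or [a + 1], the sum of the two boundaries
   attached to [x] and [y] is the full rectangle of good triples for [x + y]. *)
Lemma good_triple_split a b x y q r :
  x <= a -> y <= b -> x <= y.+1 -> b + x <= (a + y).+1 ->
  good_triple (a + b) (x + y) q r ->
  exists q1 r1 q2 r2, [/\ q = q1 + q2, r = r1 + r2,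
    cyc_edge_triple a x q1 r1 & cyc_edge_triple b y q2 r2].
Proof.
move=> xa yb xy bx /and5P[h1 h2 h3 h4 h5].
(* The first pair is put on a side where [q1 - r1] is [x] or [- x], the second on a side where
   [q2 + r2] is [y] or [2 * b - y]; the tests decide which. By parity a failed test fails by at
   least 2, which absorbs the slack of 1 in the hypotheses. *)
have [hs|hs] := leqP (q + r + x) (2 * a + y); have [ht|ht] := leqP (r + x) (q + y).
- exists ((q + r + x - y)./2), ((q + r - y - x)./2), ((y + q - r - x)./2), ((y + r + x - q)./2).
  by split; [lia | lia | split; [split; lia | constructor 3; lia] |
    split; [split; lia | constructor 1; lia]].
- exists ((q + r - x - y)./2), ((q + r - y + x)./2), ((y + q + x - r)./2), ((y + r - x - q)./2).
  by split; [lia | lia | split; [split; lia | constructor 4; lia] |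
    split; [split; lia | constructor 1; lia]].
- exists ((q + r + x + y - 2 * b)./2), ((q + r + y - x - 2 * b)./2),
         ((2 * b - y + q - r - x)./2), ((2 * b - y + r + x - q)./2).
  by split; [lia | lia | split; [split; lia | constructor 3; lia] |
    split; [split; lia | constructor 2; lia]].
- exists ((q + r - x + y - 2 * b)./2), ((q + r + y + x - 2 * b)./2),
         ((2 * b - y + q + x - r)./2), ((2 * b + r - y - x - q)./2).
  by split; [lia | lia | split; [split; lia | constructor 4; lia] |
    split; [split; lia | constructor 2; lia]].
Qed.

(** Eliminating [r] from the inequalities leaves conditions on [q] alone. Then [q], and after it
    [r], is the greatest of its lower bounds; all these bounds have the required parity, so no
    rounding occurs. *)
Lemma good_triple_choice g p x x' y y' :
  odd p = odd x (+) odd y -> odd x' = odd x (+) odd g -> odd y' = odd y (+) odd g ->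
  p <= g -> x <= g -> x' <= g -> y <= g -> y' <= g ->
  g <= x' + x -> g <= y' + y ->
  p <= x + y -> p <= x' + y' -> g <= p + x + y' -> g <= p + x' + y ->
  exists q r, [/\ good_triple g p q r,
    [/\ q <= x, g <= q + x' & odd q = odd x] & [/\ r <= y, g <= r + y' & odd r = odd y]].
Proof.
move=> op ox oy pg xg xg' yg yg' gx gy h1 h2 h3 h4.
have q_parity q : [\/ q = g - x', q + y' + p = g | q + y = p] -> odd q = odd x.
  case=> [->|/(congr1 odd)|/(congr1 odd)].
  - by rewrite oddB // ox; case: (odd x); case: (odd g).
  - by rewrite !oddD oy op; case: (odd q); case: (odd x); case: (odd y); case: (odd g).
  - by rewrite !oddD op; case: (odd q); case: (odd x); case: (odd y).
have r_parity q r : odd q = odd x -> [\/ r = g - y', r + q = p | r + p = q] -> odd r = odd y.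
  move=> oq; case=> [->|/(congr1 odd)|/(congr1 odd)].
  - by rewrite oddB // oy; case: (odd y); case: (odd g).
  - by rewrite !oddD op oq; case: (odd r); case: (odd x); case: (odd y).
  - by rewrite !oddD op oq; case: (odd r); case: (odd x); case: (odd y).
have [q [q1 q2 [q3 q4 q5 q6] oq]] : exists q, [/\ q <= x, g <= q + x',
    [/\ g <= q + y' + p, p <= q + y, q <= p + y & p + q <= g + y'] & odd q = odd x].
  have [q [Hq Hpar]] : exists q, ([/\ q <= x, g <= q + x', g <= q + y' + p, p <= q + y &
      q <= p + y /\ p + q <= g + y']) /\ [\/ q = g - x', q + y' + p = g | q + y = p].
    clear op ox oy q_parity r_parity.
    have [c1|c1] := leqP (g + y) (p + x').
      have [c2|c2] := leqP (g + y) (2 * p + y').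
        by exists (p - y); split; [split; lia | constructor 3; lia].
      by exists (g - y' - p); split; [split; lia | constructor 2; lia].
    have [c2|c2] := leqP x' (p + y').
      by exists (g - x'); split; [split; lia | constructor 1].
    by exists (g - y' - p); split; [split; lia | constructor 2; lia].
  by case: Hq => ? ? ? ? []; exists q; split=> //; exact: q_parity.
have [r [r1 r2 [r3 r4 r5 r6] or]] : exists r, [/\ r <= y, g <= r + y',
    [/\ p <= q + r, q <= p + r, r <= p + q & p + q + r <= 2 * g] & odd r = odd y].
  have [r [Hr Hpar]] : exists r, ([/\ r <= y, g <= r + y', p <= q + r, q <= p + r &
      r <= p + q /\ p + q + r <= 2 * g]) /\ [\/ r = g - y', r + q = p | r + p = q].
    clear op ox oy q_parity r_parity oq.
    have [c1|c1] := leqP p q.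
      have [c2|c2] := leqP (g + p) (q + y').
        by exists (q - p); split; [split; lia | constructor 3; lia].
      by exists (g - y'); split; [split; lia | constructor 1].
    have [c2|c2] := leqP (g + q) (p + y').
      by exists (p - q); split; [split; lia | constructor 2; lia].
    by exists (g - y'); split; [split; lia | constructor 1].
  by case: Hr => ? ? ? ? []; exists r; split=> //; exact: r_parity oq _.
exists q, r; split=> //; apply/and5P; split=> //.
by rewrite !oddD op oq or; case: (odd x); case: (odd y).
Qed.

(** * The signed metric of the torus *)

Section Torus.
Variables a b : nat.
Hypotheses (a_gt0 : 0 < a) (b_gt0 : 0 < b).

Definition tdist (u v : int * int) : nat :=
  cdist a (u.1 - v.1) + cdist b (u.2 - v.2).

Lemma tdist_good u v w :
  good_triple (a + b) (tdist u w) (tdist u v) (tdist v w).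
Proof.
have := cdist_good (u.1 - v.1)%R (v.1 - w.1)%R a_gt0.
have := cdist_good (u.2 - v.2)%R (v.2 - w.2)%R b_gt0.
rewrite !addrA !subrK /good_triple /tdist.
move: (cdist a _) (cdist a _) (cdist a _) (cdist b _) (cdist b _) (cdist b _); lia.
Qed.

Lemma tdistC u v : tdist u v = tdist v u.
Proof. by rewrite /tdist -(cdistN _ a_gt0) -(cdistN _ b_gt0) !opprB. Qed.

Lemma tdist_le u v : tdist u v <= a + b.
Proof. by rewrite leq_add ?cdist_le. Qed.

Lemma tdist_extend u v q r : a <= b <= a.+1 ->
  good_triple (a + b) (tdist u v) q r ->
  exists w, tdist u w = q /\ tdist v w = r.
Proof.
move=> hab H.
have xa := cdist_le (u.1 - v.1)%R a_gt0; have yb := cdist_le (u.2 - v.2)%R b_gt0.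
suff [q1 [r1 [q2 [r2 [-> -> H1 H2]]]]] : exists q1 r1 q2 r2, [/\ q = q1 + q2, r = r1 + r2,
    cyc_edge_triple a (cdist a (u.1 - v.1)) q1 r1 &
    cyc_edge_triple b (cdist b (u.2 - v.2)) q2 r2].
  have [w1 [E1 E2]] := cdist_extend a_gt0 H1.
  have [w2 [E3 E4]] := cdist_extend b_gt0 H2.
  by exists (w1, w2); rewrite /tdist /= E1 E2 E3 E4.
move: H; rewrite /tdist; move: (cdist a _) (cdist b _) xa yb => x y xa yb H.
(* As [b] is [a] or [a + 1], the hypotheses of the splitting hold for one order of the two
   coordinates. *)
have [h|h] : (x <= y.+1 /\ b + x <= (a + y).+1) \/ (y <= x.+1 /\ a + y <= (b + x).+1) by lia.
  by apply: good_triple_split => //; case: h.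
have [] := @good_triple_split b a y x q r yb xa (proj1 h) (proj2 h).
  by rewrite addnC (addnC y).
move=> q2 [r2 [q1 [r1 [-> -> ? ?]]]]; exists q1, r1, q2, r2.
by split=> //; rewrite addnC.
Qed.

(* The distance from [u] to [v] if [s] is false, to the antipode of [v] otherwise. *)
Definition sdist (s : bool) u v := if s then a + b - tdist u v else tdist u v.

(** The four sign patterns give the four inequalities of [good_triple]. *)
Lemma sdist_comp s t u v w :
  sdist (s (+) t) u w <= sdist s u v + sdist t v w /\
  odd (sdist (s (+) t) u w) = odd (sdist s u v + sdist t v w).
Proof.
have := tdist_good u v w; have := tdist_le u w; have := tdist_le u v; have := tdist_le v w.
by rewrite /good_triple /sdist; case: s; case: t => /=; lia.
Qed.

Lemma sdistC s u v : sdist s u v = sdist s v u.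
Proof. by rewrite /sdist tdistC. Qed.

Lemma sdist_translate s (u v : int * int) k l :
  sdist s ((u.1 + k * (2 * a)%:Z)%R, (u.2 + l * (2 * b)%:Z)%R) v = sdist s u v.
Proof.
rewrite /sdist /tdist /= -!addrA ![(_ * _ - _)%R]addrC !addrA.
by rewrite (cdistDm _ _ a_gt0) (cdistDm _ _ b_gt0).
Qed.

Lemma sdist_antipode s (u v : int * int) :
  sdist s ((u.1 + a%:Z)%R, (u.2 + b%:Z)%R) v = sdist (~~ s) u v.
Proof.
rewrite /sdist /tdist /= -!addrA ![(_%:Z - _)%R]addrC !addrA.
rewrite (cdist_antipode _ a_gt0) (cdist_antipode _ b_gt0).
have := cdist_le (u.1 - v.1)%R a_gt0; have := cdist_le (u.2 - v.2)%R b_gt0.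
move: (cdist _ _) (cdist _ _) => ? ?; case: s => /=; lia.
Qed.


(* [dx], [dy], [dz] are upper bounds for the signed distances from the new point
   to [u], from the new point to [v], and from [u] to [v]. *)
Lemma sdist_extend u v (dx dy dz : bool -> nat) : a <= b <= a.+1 ->
  odd (dx true) = odd (dx false) (+) odd (a + b) ->
  odd (dy true) = odd (dy false) (+) odd (a + b) ->
  odd (dz false) = odd (dx false) (+) odd (dy false) ->
  (forall s, dx s <= a + b /\ dy s <= a + b) ->
  a + b <= dx true + dx false -> a + b <= dy true + dy false ->
  (forall s t, dz (s (+) t) <= dx s + dy t) ->
  (forall s, sdist s u v <= dz s) -> odd (sdist false u v) = odd (dz false) ->
  exists w, (forall s, sdist s w u <= dx s /\ sdist s w v <= dy s) /\
    odd (sdist false w u) = odd (dx false) /\ odd (sdist false w v) = odd (dy false).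
Proof.
move=> hab px py pz bnd gx gy tri le pp.
have [q [r [gt [q1 q2 oq] [r1 r2 or]]]] : exists q r,
    [/\ good_triple (a + b) (tdist u v) q r,
      [/\ q <= dx false, a + b <= q + dx true & odd q = odd (dx false)] &
      [/\ r <= dy false, a + b <= r + dy true & odd r = odd (dy false)]].
  have [lx1 ly1] := bnd true; have [lx2 ly2] := bnd false.
  have := tdist_le u v; have := le false; have := le true; rewrite /sdist => e1 e2 e3.
  apply: good_triple_choice => //; [by rewrite -pz| | | |].
  - exact: leq_trans e2 (tri false false).
  - exact: leq_trans e2 (tri true true).
  - by have := tri false true; clear -e1 e3; rewrite /=; lia.
  - by have := tri true false; clear -e1 e3; rewrite /=; lia.
have [w [E1 E2]] := tdist_extend hab gt.
exists w; rewrite /sdist tdistC E1 [tdist w v]tdistC E2; split=> //.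
by move=> s; clear -q1 q2 r1 r2; case: s; lia.
Qed.
End Torus.

(** * Signed distances in a signed graph *)

Section SignedWalks.
Variable G : sgraph.
Implicit Types (x y z : vert G) (s t : bool) (n m : nat).

Definition walks x y s n : Prop := exists w : seq (edge G * vert G),
  [/\ walk x w, last x (unzip2 w) = y, \big[addb/false]_(t <- w) neg t.1 = s & size w = n].

Lemma walks0 x : walks x x false 0.
Proof. by exists [::]; rewrite big_nil. Qed.

Lemma walks1 (e : edge G) x y : ends e = [set x; y] -> walks x y (neg e) 1.
Proof. by move=> E; exists [:: (e, y)]; rewrite /= E eqxx big_seq1. Qed.

Lemma walk_cat x (w1 w2 : seq (edge G * vert G)) :
  walk x (w1 ++ w2) = walk x w1 && walk (last x (unzip2 w1)) w2.
Proof. by elim: w1 x => //= -[e y] w1 IH x /=; rewrite IH andbA. Qed.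

Lemma walks_cat x y z s t n m :
  walks x y s n -> walks y z t m -> walks x z (s (+) t) (n + m).
Proof.
move=> [w1 [W1 L1 S1 N1]] [w2 [W2 L2 S2 N2]]; exists (w1 ++ w2).
rewrite walk_cat W1 L1 /unzip2 map_cat last_cat -/(unzip2 w1) L1.
by rewrite big_cat /= S1 S2 size_cat N1 N2.
Qed.

Lemma walks_sym x y s n : walks x y s n -> walks y x s n.
Proof.
move=> [w [W L <- <-]] {s n}; elim: w x W L => [x _ <-|[e z] w IH x /= /andP[/eqP E W] L].
  by rewrite big_nil; exact: walks0.
rewrite big_cons addbC -addn1; apply: walks_cat (IH z W L) _.
by apply: walks1; rewrite setUC.
Qed.

Lemma connect_walks x y : connect (@adj G) x y -> exists s n, walks x y s n.
Proof.
move=> /connectP[p]; elim: p x => [|z p IH] x /=;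
  first by move=> _ ->; exists false, 0; exact: walks0.
move=> /andP[/existsP[e /eqP E] pz] /(IH z pz)[s [n W]].
exists (neg e (+) s), (1 + n); apply: walks_cat W; exact: walks1.
Qed.

Lemma has_closed_walkP ij n :
  has_closed_walk G ij n <-> (exists x, walks x x ij.1 n) /\ ij.2 = odd n.
Proof.
split.
  move=> /existsP[x /existsP[w /andP[/andP[W /eqP L] /eqP <-]]].
  by rewrite /walk_type /= size_tuple; split=> //; exists x, w; rewrite size_tuple.
case: ij => s j /= [[x [w [W L S N]]] ->]; apply/existsP; exists x.
have sz : size w == n by rewrite N.
by apply/existsP; exists (Tuple sz); rewrite /closed_walk /walk_type /= W L eqxx S N eqxx.
Qed.

End SignedWalks.

Lemma closed_walk_le_girth (B G : sgraph) ij n :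
  leq_inf (girth B ij) (girth G ij) -> has_closed_walk G ij n ->
  exists2 m, m <= n & has_closed_walk B ij m.
Proof.
move=> + Gn; rewrite /girth; case: pselect => exB; case: pselect => [exG|noG].
- case: ex_minnP => m Bm _; case: ex_minnP => k _ mink mk.
  by exists m => //; apply: leq_trans mk (mink _ Gn).
- by case: noG; exists n.
- by [].
- by case: noG; exists n.
Qed.

Section Metric.
Variables (G : sgraph) (g : nat).
Hypothesis g_gt0 : 0 < g.
(** What the girth conditions provide: closed walks of a type that TT(g) does not have are excluded,
    and negative ones are at least as long as those of TT(g). *)
Hypothesis closed_walks : forall (x : vert G) s n, walks x x s n ->
  odd n = s && odd g /\ (s -> g <= n).
Hypothesis G_conn : connected_graph G.
Implicit Types (x y z : vert G) (s t : bool) (n m : nat).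

(** The parity due to a walk of sign [s], computed from a walk of any sign, so that it makes sense
    even when no walk of sign [s] exists. *)
Definition admissible x y s n : Prop := exists t m,
  walks x y t m /\ odd n = odd m (+) ((s (+) t) && odd g).

Lemma admissible_walks x y s n : walks x y s n -> admissible x y s n.
Proof. by exists s, n; rewrite addbb addbF. Qed.

Lemma admissible_cat x y z s t n m :
  admissible x y s n -> admissible y z t m -> admissible x z (s (+) t) (n + m).
Proof.
move=> [s1 [n1 [W1 E1]]] [s2 [n2 [W2 E2]]]; exists (s1 (+) s2), (n1 + n2).
split; first exact: walks_cat W2.
rewrite !oddD E1 E2; case: s s1 t s2 (odd n1) (odd n2) (odd g) {W1 W2 E1 E2};
by do 6 case.
Qed.

Lemma admissible_sym x y s n : admissible x y s n -> admissible y x s n.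
Proof. by move=> [t [m [/walks_sym W E]]]; exists t, m. Qed.

(** One walk followed by the reverse of the other is closed, and [closed_walks] fixes its parity. *)
Lemma admissible_odd x y s t n m : admissible x y s n -> admissible x y t m ->
  odd n = odd m (+) ((s (+) t) && odd g).
Proof.
move=> [s1 [n1 [W1 E1]]] [s2 [n2 [W2 E2]]].
have [+ _] := closed_walks (walks_cat W1 (walks_sym W2)).
rewrite oddD E1 E2; case: s s1 t s2 (odd n1) (odd n2) (odd g) {W1 W2 E1 E2};
by do 6 case.
Qed.

(* The second alternative caps distances near [g]: in a balanced graph there are no
   walks of one of the two signs. *)
Definition reach x y s n : Prop := walks x y s n \/ (g.-1 <= n /\ admissible x y s n).

Lemma reach_admissible x y s n : reach x y s n -> admissible x y s n.
Proof. by case=> [/admissible_walks|[]]. Qed.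

Lemma reach_cat x y z s t n m :
  reach x y s n -> reach y z t m -> reach x z (s (+) t) (n + m).
Proof.
move=> R1 R2; have A := admissible_cat (reach_admissible R1) (reach_admissible R2).
case: R1 R2 => [W1|[n1 _]] [W2|[n2 _]]; first by left; exact: walks_cat W2.
- by right; split=> //; apply: leq_trans n2 (leq_addl _ _).
- by right; split=> //; apply: leq_trans n1 (leq_addr _ _).
- by right; split=> //; apply: leq_trans n1 (leq_addr _ _).
Qed.

Lemma reach_sym x y s n : reach x y s n -> reach y x s n.
Proof. by case=> [/walks_sym|[? /admissible_sym]]; [left | right]. Qed.

(** The cap [g.-1] itself has the wrong parity for a negative closed walk, so a capped value is at
    least [g]. *)
Lemma reach_closed x n : reach x x true n -> g <= n.
Proof.
case=> [/closed_walks[_]|[gn /admissible_odd/(_ (admissible_walks (walks0 x)))]]; first exact.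
rewrite /= => E; rewrite -(prednK g_gt0) ltn_neqAle gn andbT.
by apply/eqP => E'; move: E; rewrite -E' -{2}(prednK g_gt0) /=; case: odd.
Qed.

(** One of [g.-1] and [g] has the admissible parity; this is why the cap is at [g.-1]. *)
Lemma reach_exists x y s : exists2 n, n <= g & reach x y s n.
Proof.
have [t [m W]] : exists t m, walks x y t m.
  apply: connect_walks; have [_ /(_ x y (in_setT _) (in_setT _))] := G_conn.
  by apply: connect_sub => u v /and3P[_ _ uv]; exact: connect1.
pose b := odd m (+) ((s (+) t) && odd g).
exists (if odd g == b then g else g.-1); first by case: ifP => // _; exact: leq_pred.
right; split; first by case: ifP => // _; exact: leq_pred.
exists t, m; split=> //; rewrite -/b; case: ifP => [/eqP//|].
by rewrite -{1}(prednK g_gt0) /=; case: odd; case: b.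
Qed.

Lemma reach_ex_minn x y s : exists n, `[< reach x y s n >].
Proof. by have [n _ R] := reach_exists x y s; exists n; exact/asboolP. Qed.

Definition dist x y s : nat := ex_minn (reach_ex_minn x y s).

Lemma dist_reach x y s : reach x y s (dist x y s).
Proof. by rewrite /dist; case: ex_minnP => n /asboolP. Qed.

Lemma dist_min x y s n : reach x y s n -> dist x y s <= n.
Proof. by rewrite /dist; case: ex_minnP => m _ H /asboolP/H. Qed.

Lemma dist_le x y s : dist x y s <= g.
Proof. by have [n ng /dist_min] := reach_exists x y s; move/leq_trans; apply. Qed.

Lemma dist_tri x y z s t : dist x z (s (+) t) <= dist x y s + dist y z t.
Proof. exact/dist_min/reach_cat/dist_reach/dist_reach. Qed.

Lemma distC x y s : dist x y s = dist y x s.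
Proof. by apply/eqP; rewrite eqn_leq !dist_min //; exact/reach_sym/dist_reach. Qed.

Lemma dist_odd x y s : odd (dist x y s) = odd (dist x y false) (+) (s && odd g).
Proof.
rewrite -[in RHS](addbF s); apply: admissible_odd; exact/reach_admissible/dist_reach.
Qed.

Lemma dist_odd_cat x y z :
  odd (dist x z false) = odd (dist x y false) (+) odd (dist y z false).
Proof.
have A u v := reach_admissible (dist_reach u v false).
by rewrite (admissible_odd (A x z) (admissible_cat (A x y) (A y z))) oddD /= addbF.
Qed.

(** Going to [y] with negative sign and back with positive sign is closed and negative, so
    [reach_closed] applies. *)
Lemma dist_antipode x y : g <= dist x y true + dist x y false.
Proof.
rewrite [dist x y false]distC; apply: (@reach_closed x).
exact: (reach_cat (dist_reach x y true) (dist_reach y x false)).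
Qed.

(** * Construction of the map to the torus *)

Variables a b : nat.
Hypotheses (a_gt0 : 0 < a) (b_gt0 : 0 < b) (hab : a <= b <= a.+1) (hg : a + b = g).

Definition compatible (phi : vert G -> int * int) x y : Prop :=
  (forall s, sdist a b s (phi x) (phi y) <= dist x y s) /\
  odd (sdist a b false (phi x) (phi y)) = odd (dist x y false).

Lemma compatible_sym phi x y : compatible phi x y -> compatible phi y x.
Proof.
move=> [le od]; split=> [s|]; rewrite (sdistC a_gt0 b_gt0) distC //; exact: le.
Qed.

(** Serves when the eliminated vertex has a single neighbour, which is then taken twice. *)
Lemma compatible_refl phi x : compatible phi x x.
Proof.
have E : tdist a b (phi x) (phi x) = 0.
  have c0 n : 0 < n -> cdist n 0 = 0.
    by move=> n0; apply: cdistE => //; split=> //; exists 0%R; left; rewrite GRing.mul0r.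
  by rewrite /tdist !GRing.subrr !c0.
split=> [[]|]; rewrite /sdist E //.
  rewrite hg subn0; exact: reach_closed (dist_reach x x true).
have A := reach_admissible (dist_reach x x false).
by rewrite (admissible_odd A (admissible_walks (walks0 x))).
Qed.

(** The relation [e] changes during the elimination, whereas [dist] is always that of the whole
    graph [G]; so the triangle inequalities through [v] hold for the pairs that filling creates. *)
Lemma compatible_exists (e : rel (vert G)) (A : {set vert G}) :
  symmetric e -> irreflexive e -> ~ complete_minor_in e A 4 ->
  exists phi, {in A &, forall x y, e x y -> compatible phi x y}.
Proof.
move: e A; apply: (@K4_minor_free_ind _ (fun e A =>
    exists phi, {in A &, forall x y, e x y -> compatible phi x y}))
  => [e|e A v se ie vA v2 [phi Hphi]].
  by exists (fun _ => (0, 0)%R) => x y; rewrite inE.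
have [N0|[x xN]] := set_0Vmem (nbrs e A v).
  have nv z : z \in A -> e v z -> False.
    by move=> zA evz; have : z \in nbrs e A v; [rewrite inE zA | rewrite N0 inE].
  exists phi => y z yA zA eyz; apply: Hphi; rewrite ?inE ?yA ?zA ?andbT;
    last by rewrite /fill /= eyz.
    by apply/eqP => E; apply: (nv z zA); rewrite -E.
  by apply/eqP => E; apply: (nv y yA); rewrite se -E.
have [y yN Nxy] : exists2 y, y \in nbrs e A v & forall z, z \in nbrs e A v -> z = x \/ z = y.
  have [N1|[y]] := set_0Vmem (nbrs e A v :\ x).
    exists x => // z zN; left; apply/eqP; apply: contraTT isT => zx.
    by have : z \in nbrs e A v :\ x; [rewrite in_setD1 zx | rewrite N1 inE].
  rewrite in_setD1 => /andP[yx yN]; exists y => // z zN.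
  have [->|zx] := eqVneq z x; first by left.
  have [->|zy] := eqVneq z y; first by right.
  by move: v2; rewrite leqNgt => /card_gt2P[]; exists x, y, z;
    split; split=> //; rewrite eq_sym.
have [[xA evx] [yA evy]] : (x \in A /\ e v x) /\ (y \in A /\ e v y).
  by move: xN yN; rewrite !inE => /andP[-> ->] /andP[-> ->].
have nv z : e v z -> z != v by apply: contraTneq => ->; rewrite ie.
have Cxy : compatible phi x y.
  have [<-|nxy] := eqVneq x y; first exact: compatible_refl.
  by apply: Hphi; rewrite ?inE ?xA ?yA ?nv // /fill /= nxy evx evy orbT.
have [w [Hw [ox oy]]] : exists w,
    (forall s, sdist a b s w (phi x) <= dist v x s /\ sdist a b s w (phi y) <= dist v y s) /\
    odd (sdist a b false w (phi x)) = odd (dist v x false) /\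
    odd (sdist a b false w (phi y)) = odd (dist v y false).
  have [le od] := Cxy.
  apply: (@sdist_extend a b a_gt0 b_gt0 (phi x) (phi y)
    (dist v x) (dist v y) (dist x y)) => //.
  - by rewrite dist_odd hg.
  - by rewrite dist_odd hg.
  - by rewrite (dist_odd_cat x v y) (distC x v).
  - by move=> s; rewrite hg !dist_le.
  - by rewrite hg dist_antipode.
  - by rewrite hg dist_antipode.
  - by move=> s t; rewrite (distC v x); exact: dist_tri.
pose psi z := if z == v then w else phi z.
have Cv z : z \in A -> e v z -> compatible psi v z.
  move=> zA evz; have zN : z \in nbrs e A v by rewrite inE zA.
  rewrite /compatible /psi eqxx (negPf (nv _ evz)).
  by have [->|->] := Nxy z zN; split=> // s; case: (Hw s).
exists psi => y' z yA' zA eyz.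
have [E|ny] := eqVneq y' v; first by rewrite E in eyz *; exact: Cv.
have [E|nz] := eqVneq z v.
  by rewrite E in eyz *; apply: compatible_sym; apply: Cv => //; rewrite se.
rewrite /compatible /psi (negPf ny) (negPf nz); apply: Hphi; rewrite ?inE ?ny ?nz //.
by rewrite /fill /= eyz.
Qed.

(** The edge is a walk of length 1, which bounds the distance by 1; parity excludes 0. *)
Lemma edge_sdist phi x y (e : edge G) : ends e = [set x; y] ->
  compatible phi x y -> sdist a b (neg e) (phi x) (phi y) = 1.
Proof.
move=> /walks1 W [le od].
have le1 : sdist a b (neg e) (phi x) (phi y) <= 1.
  by apply: leq_trans (le _) _; apply: dist_min; left.
suff : odd (sdist a b (neg e) (phi x) (phi y)) by case: (sdist _ _ _ _ _) le1 => [|[]].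
have := dist_odd x y (neg e).
have A := reach_admissible (dist_reach x y (neg e)).
rewrite (admissible_odd A (admissible_walks W)) addbb /= -od /sdist.
by case: (neg e); rewrite /= ?oddB ?tdist_le // ?hg ?addbF => E;
  rewrite ?[_ (+) odd (tdist _ _ _ _)]addbC -E.
Qed.

End Metric.

(** * TT(g) as a quotient of the torus *)

Lemma cdist_small n (i j : nat) : 0 < n -> i < 2 * n -> j < 2 * n ->
  cdist n (i%:Z - j%:Z)%R = minn (maxn (i - j) (j - i)) (2 * n - maxn (i - j) (j - i)).
Proof.
move=> n0 hi hj; apply: cdistE => //; split; first by lia.
have [h|h] := leqP (maxn (i - j) (j - i)) n.
  by exists 0%R; lia.
by have [ij|ij] := leqP i j; [exists (-1)%R | exists 1%R]; lia.
Qed.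

Lemma eq_modS i j n : i < n -> j < n ->
  (i == j + 1 %[mod n]) = (i == j.+1) || (i == 0) && (j.+1 == n).
Proof.
move=> hi hj; rewrite addn1 modn_small //.
have [lt|] := ltnP j.+1 n; first by rewrite modn_small //; lia.
by move=> ge; have -> : j.+1 = n by [lia]; rewrite modnn eqxx andbT (ltn_eqF hi).
Qed.

Lemma cyclic_adjE i j n : 0 < n -> i < 2 * n -> j < 2 * n ->
  let c := maxn (i - j) (j - i) in
  [|| (i == j.+1) || (i == 0) && (j.+1 == 2 * n), j == i.+1 | (j == 0) && (i.+1 == 2 * n)] =
  (minn c (2 * n - c) == 1).
Proof.
move=> n0 hi hj c; rewrite /c; apply/idP/eqP.
  case/or3P=> [/orP[/eqP->|/andP[/eqP-> /eqP ?]]|/eqP->|/andP[/eqP-> /eqP ?]]; lia.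
have [ij|ij|->] := ltngtP i j => E; last by lia.
  by have [E2|E2] : j = i.+1 \/ (i = 0 /\ j.+1 = 2 * n) by [lia];
    rewrite ?E2 ?eqxx ?orbT //; case: E2 => -> ->; rewrite ?eqxx ?orbT.
by have [E2|E2] : i = j.+1 \/ (j = 0 /\ i.+1 = 2 * n) by [lia];
    rewrite ?E2 ?eqxx ?orbT //; case: E2 => -> ->; rewrite ?eqxx ?orbT.
Qed.

Lemma set2_inj (T : finType) (x y z t : T) : [set x; y] = [set z; t] ->
  (x = z /\ y = t) \/ (x = t /\ y = z).
Proof.
move=> /setP E; have := E x; have := E y; have := E z; have := E t.
rewrite !inE !eqxx !orbT => /orP[]/eqP? /orP[]/eqP? /esym/orP[]/eqP? /esym/orP[]/eqP?.
all: by first [left; split; congruence | right; split; congruence].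
Qed.

Section Grid.
Variable g : nat.
Hypothesis g_gt1 : 2 <= g.
Local Notation a := (g./2).
Local Notation b := (uphalf g).

Let a_gt0 : 0 < a. Proof. by lia. Qed.
Let b_gt0 : 0 < b. Proof. by lia. Qed.
Let hab : a <= b <= a.+1. Proof. by lia. Qed.
Let hg : a + b = g. Proof. by lia. Qed.

(** The vertices of TT(g) fill the first [b] of the [2 * b] rows of the torus, and their antipodes
    the other rows. *)
Definition torus_point (x : T_vert g) : int * int := (x.1%:Z, x.2%:Z)%R.

(** Row indices differ by less than [b], so only the first coordinate can wrap around. *)
Lemma tdist_torus_point (x y : T_vert g) :
  let c := maxn (x.1 - y.1) (y.1 - x.1) in let r := maxn (x.2 - y.2) (y.2 - x.2) in
  tdist a b (torus_point x) (torus_point y) = minn c (2 * a - c) + r.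
Proof.
have h2 (i : 'I_b) : i < 2 * b by rewrite mul2n -addnn ltn_addr.
rewrite /tdist /torus_point !cdist_small //=; congr (_ + _).
have := ltn_ord x.2; have := ltn_ord y.2.
by move: (b) (nat_of_ord x.2) (nat_of_ord y.2) => n i j; lia.
Qed.

Lemma mem_pairs_of (r : rel (T_vert g)) x y :
  ([set x; y] \in pairs_of r) = r x y || r y x.
Proof.
apply/imsetP/orP => [[p] | [rxy|ryx]].
- by rewrite inE => rp /set2_inj[] [-> ->]; [left | right].
- by exists (x, y); rewrite ?inE.
- by exists (y, x); rewrite ?inE //= setUC.
Qed.

Lemma T_edges_tdist (x y : T_vert g) :
  ([set x; y] \in T_edges g) = (tdist a b (torus_point x) (torus_point y) == 1).
Proof.
rewrite tdist_torus_point /T_edges inE !mem_pairs_of /T_vertical /T_horizontal /=.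
rewrite -!val_eqE /= ![_ + 1 == _ %[mod _]]eq_sym !eq_modS //.
have := cyclic_adjE a_gt0 (ltn_ord x.1) (ltn_ord y.1).
have := cyclic_adjE a_gt0 (ltn_ord y.1) (ltn_ord x.1).
rewrite [maxn (y.1 - x.1) _]maxnC /= => -> ->.
rewrite [_ == nat_of_ord x.1]eq_sym [_ == nat_of_ord x.2]eq_sym -andb_orr orbb.
have := ltn_ord x.1; have := ltn_ord y.1.
move: (a) a_gt0 (nat_of_ord x.1) (nat_of_ord y.1) (nat_of_ord x.2) (nat_of_ord y.2).
move=> n n0 i j k l hj hi; set m := minn _ _.
have -> : (i == j) = (m == 0) by clear -n0 hi hj; lia.
clearbody m; clear; apply/idP/eqP.
  by case/orP=> [/andP[/eqP-> /orP[]/eqP->]|/andP[/eqP-> /eqP->]]; lia.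
by case: m => [|[]] //; lia.
Qed.

(** The coordinate distances are at most [a] and [b.-1], whose sum is [g.-1], so both are extreme.
    Equivalently, [x] is adjacent to the antipode of [y] on the torus. *)
Lemma J_edges_tdist (x y : T_vert g) :
  ([set x; y] \in J_edges g) = (tdist a b (torus_point x) (torus_point y) == g.-1).
Proof.
rewrite tdist_torus_point mem_pairs_of /antipodal /=.
have -> : g.-1 = (a + b).-1 by rewrite hg.
have modD (i : nat) : i < 2 * a -> (i + a) %% (2 * a) = if i < a then i + a else i - a.
  move=> hi; case: ltnP => ia; first by rewrite modn_small; lia.
  by have -> : i + a = (i - a) + 2 * a by [lia]; rewrite modnDr modn_small; lia.
rewrite !modD //.
have := ltn_ord y.2; have := ltn_ord x.2; have := ltn_ord y.1; have := ltn_ord x.1.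
move: (a) (b) a_gt0 b_gt0 (nat_of_ord x.1) (nat_of_ord y.1) (nat_of_ord x.2) (nat_of_ord y.2).
move=> n m n0 m0 i j k l hi hj hk hl; set c := minn _ _; set r := maxn (k - l) (l - k).
have shift i' j' : i' < 2 * n -> j' < 2 * n -> (j' == if i' < n then i' + n else i' - n) =
    (minn (maxn (i' - j') (j' - i')) (2 * n - maxn (i' - j') (j' - i')) == n).
  by clear -n0 => hi hj; case: ltnP => h; apply/eqP/eqP; lia.
rewrite !shift // (maxnC (j - i)) -/c.
have cn : c <= n by rewrite /c; lia.
clearbody c; rewrite /r; clear -m0 cn hk hl n0; apply/idP/eqP.
  by case/orP=> /and3P[/eqP-> /eqP-> /eqP->]; lia.
move=> E; have /andP[/eqP-> /orP[]/andP[/eqP-> /eqP->]] :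
  (c == n) && ((k == 0) && (l == m.-1) || (l == 0) && (k == m.-1)) by lia.
  by rewrite !eqxx.
by rewrite !eqxx orbT.
Qed.

Lemma TTJ_edge_sdist (e : edge (TTJ g)) (x y : vert (TTJ g)) : ends e = [set x; y] ->
  sdist a b (neg e) (torus_point x) (torus_point y) = 1.
Proof.
case: e => -[e He] /= Ee; move: (He); rewrite Ee /sdist ?T_edges_tdist ?J_edges_tdist => /eqP-> //.
by rewrite hg; lia.
Qed.

Lemma TTJ_edge_exists s (x y : vert (TTJ g)) :
  sdist a b s (torus_point x) (torus_point y) = 1 ->
  exists e : edge (TTJ g), ends e = [set x; y] /\ neg e = s.
Proof.
rewrite /sdist; case: s => [H|/eqP].
  have J : [set x; y] \in J_edges g.
    by rewrite J_edges_tdist; have := tdist_le a_gt0 b_gt0 (torus_point x) (torus_point y); lia.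
  by exists (inr (exist (fun d => d \in J_edges g) _ J)).
by rewrite -T_edges_tdist => T; exists (inl (exist (fun d => d \in T_edges g) _ T)).
Qed.

Lemma walks_sdist s n (x y : vert (TTJ g)) : walks x y s n ->
  sdist a b s (torus_point x) (torus_point y) <= n /\
  odd (sdist a b s (torus_point x) (torus_point y)) = odd n.
Proof.
move=> [w [W L <- <-]] {s n}; elim: w x W L => [x _ /= ->|[e z] w IH x /= /andP[/eqP E W] L].
  by rewrite big_nil /sdist tdist_torus_point !subnn !maxnn min0n.
have [le od] := IH z W L.
have [le' od'] := sdist_comp a_gt0 b_gt0 (neg e) (\big[addb/false]_(t <- w) neg t.1)
  (torus_point x) (torus_point z) (torus_point y).
rewrite big_cons /=; rewrite (TTJ_edge_sdist E) in le' od'; split.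
  by apply: leq_trans le' _; rewrite add1n.
by rewrite od' oddD od.
Qed.

(** From a vertex to itself the signed distance is 0 for the positive sign and [g] for the negative
    one. *)
Lemma closed_walks_TTJ (x : vert (TTJ g)) s n : walks x x s n ->
  odd n = s && odd g /\ (s -> g <= n).
Proof.
move=> /walks_sdist; rewrite /sdist tdist_torus_point !subnn !maxnn min0n hg subn0.
by case: s => -[le <-].
Qed.

(** The covering map: modulo the periods, a point of the torus is a vertex of TT(g) or the antipode
    of one, and [l] tells which. *)
Lemma torus_lift (u : int * int) : exists (x : vert (TTJ g)) (l : bool),
  forall s v, sdist a b s u v = sdist a b (s (+) l) (torus_point x) v.
Proof.
have reduce (n : nat) (z : int) : 0 < n -> exists (i : 'I_(2 * n)) (k : int),
    (z = i%:Z + k * (2 * n)%:Z)%R.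
  move=> n0; have n2 : ((2 * n)%:Z != 0)%R by lia.
  have z0 := modz_ge0 z n2; have zn := @ltz_pmod z (2 * n)%:Z%R ltac:(lia).
  have hz : `|(z %% (2 * n)%:Z)%Z|%N < 2 * n by lia.
  exists (Ordinal hz), (z %/ (2 * n)%:Z)%Z; rewrite /= gez0_abs // GRing.addrC; exact: divz_eq.
case: u => u1 u2; have [i [k ->]] := reduce a u1 a_gt0; have [j [l ->]] := reduce b u2 b_gt0.
have tr s v := sdist_translate a_gt0 b_gt0 s (i%:Z, j%:Z)%R v k l.
have [jb|jb] := ltnP j b.
  by exists (i, Ordinal jb), false => s v; rewrite tr addbF.
have jb' : j - b < b by have := ltn_ord j; lia.
(* Row [j] is in the upper half: subtracting [a] and [b] from the coordinates passes to the
   antipode, whose first coordinate is reduced again. *)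
have [i' [k' Ei]] := reduce a (i%:Z - a%:Z)%R a_gt0.
exists (i', Ordinal jb'), true => s v; rewrite tr addbT.
rewrite -(sdist_translate a_gt0 b_gt0 (~~ s) (torus_point _) v k' 0) -(sdist_antipode a_gt0 b_gt0).
by congr (sdist _ _ _ (_, _) _); rewrite /=; lia.
Qed.

End Grid.

(** * Vertex count and the homomorphism *)

Lemma card_TTJ g : #|vert (TTJ g)| = g ^ 2 %/ 2.
Proof.
rewrite card_prod !card_ord uphalf_half; have := odd_double_half g.
move: (odd g) (g./2) => o h <-.
(* Here [o] is 0 or 1, hence equal to its square, and it is the remainder modulo 2. *)
have -> : (o + h.*2) ^ 2 = 2 * h * (o + h) * 2 + o by case: o => /=; nia.
by rewrite divnMDl // divn_small ?addn0 //; case: o.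
Qed.

Lemma cut_set2 (G : mgraph) (e : edge G) x y (l : pred (vert G)) : ends e = [set x; y] ->
  (e \in cut [set z | l z]) = l x (+) l y.
Proof.
have meets (A : {set vert G}) : [disjoint [set x; y] & A] = (x \notin A) && (y \notin A).
  by rewrite -setI_eq0 setIUl setU_eq0 !setI_eq0 !disjoints1.
by move=> E; rewrite inE E !meets !inE; case: (l x); case: (l y).
Qed.

Lemma TTJ_SP_complete g : 2 <= g -> SP_complete (TTJ g).
Proof.
move=> hg G [[simple_ends _] conn_G no_K4] girths.
have g_gt0 : 0 < g by lia.
have [a_gt0 b_gt0 hab ab] : [/\ 0 < g./2, 0 < uphalf g, g./2 <= uphalf g <= (g./2).+1 &
  g./2 + uphalf g = g] by split; lia.
(* Types are compared one by one: a closed walk of [G] yields one of the same type and no greater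
   length in TT(g), where parity and length are known. *)
have closed (x : vert G) s n : walks x x s n -> odd n = s && odd g /\ (s -> g <= n).
  move=> W; have Gn : has_closed_walk G (s, odd n) n by apply/has_closed_walkP; split=> //; exists x.
  have [m mn /has_closed_walkP[[y W'] /= ->]] := closed_walk_le_girth (girths _) Gn.
  have [-> H] := closed_walks_TTJ hg W'; split=> // /H gm; exact: leq_trans gm mn.
have adj_sym : symmetric (@adj G) by move=> x y; rewrite /adj /= setUC.
have adj_irr : irreflexive (@adj G).
  move=> x; apply/existsP=> -[e /eqP Ee].
  by have := simple_ends e; rewrite Ee setUid cards1.
have no_minor : ~ complete_minor_in (@adj G) [set: vert G] 4.
  by move=> [B [_ cB aB]]; apply: no_K4; exists B.
have [phi Hphi] := compatible_exists g_gt0 closed conn_G a_gt0 b_gt0 hab ab adj_sym adj_irr no_minor.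
(* The bit marks the vertices whose image is the antipode of a vertex of TT(g); these are the ones
   to switch at. *)
have /choice[h Hh] : forall x, exists z : vert (TTJ g) * bool, forall s v,
    sdist g./2 (uphalf g) s (phi x) v = sdist g./2 (uphalf g) (s (+) z.2) (torus_point z.1) v.
  by move=> x; have [z [l H]] := torus_lift hg (phi x); exists (z, l).
pose sign := switch [set x | (h x).2] (@neg G).
have /choice[k Hk] : forall e, exists e' : edge (TTJ g),
    ends e' = [set (h x).1 | x in ends e] /\ neg e' = sign e.
  move=> e.
  have /cards2P[x [y [_ Ee]]] : #|ends e| == 2 by rewrite simple_ends.
  have exy : adj x y by apply/existsP; exists e; rewrite Ee.
  have := edge_sdist closed a_gt0 b_gt0 ab Ee (Hphi x y (in_setT _) (in_setT _) exy).
  (* Moving the bits of both ends into the sign produces exactly the switched sign of [e]. *)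
  rewrite Hh (sdistC a_gt0 b_gt0) Hh (sdistC a_gt0 b_gt0) -addbA -(cut_set2 (fun z => (h z).2) Ee).
  by move=> /(TTJ_edge_exists hg)[e' [E1 E2]]; exists e'; rewrite Ee imsetU1 imset_set1.
refine (inhabits (@Defs.Hom G (TTJ g) sign (fun x => (h x).1) k _ _ _)).
- by exists [set x | (h x).2].
- by move=> e; case: (Hk e).
- by move=> e; case: (Hk e).
Qed.

Theorem theorem6 (g : nat) (hg : 2 <= g) :
  #|vert (TTJ g)| = g ^ 2 %/ 2 /\ SP_complete (TTJ g).
Proof. by split; [exact: card_TTJ | exact: TTJ_SP_complete]. Qed.
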